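(* Let $A,B\in su(1,1)$ and consider the control system $\dot X(t)=[A+u(t)B]X(t)$, $X(0)=I_2$, with real control $u$, on the group $SU(1,1)$, together with the cost $J(u)=\int_0^T u(t)^2\,dt$. Assume the system is controllable on $SU(1,1)$. If $\langle B,B^{\dagger}\rangle\neq 0$, then the control function $u(t)=-\langle A,B^{\dagger}\rangle/\langle B,B^{\dagger}\rangle$ (a.e.) is the only abnormal extremal for this optimal control problem, i.e. every abnormal extremal control $u$ satisfies $u(t)=-\langle A,B^{\dagger}\rangle/\langle B,B^{\dagger}\rangle$ for almost every $t$. If $\langle B,B^{\dagger}\rangle=0$, then there is no abnormal extremal.
   Context: $su(1,1)$ is the real Lie algebra spanned by $K_x=\frac12\begin{pmatrix}0&-i\\ i&0\end{pmatrix}$, $K_y=\frac12\begin{pmatrix}0&-1\\-1&0\end{pmatrix}$, $K_z=\frac12\begin{pmatrix}-i&0\\0&i\end{pmatrix}$, and $SU(1,1)$ is the corresponding connected Lie group of $2\times2$ special pseudo-unitary matrices. Inner product: $\langle M,N\rangle=2\,\mathrm{Tr}(MN^{\dagger})$, $N^{\dagger}$ the conjugate transpose. Controls are real-valued (measurable, locally integrable) functions of time, and $X(t)$ denotes the corresponding absolutely continuous solution. The system is controllable on $SU(1,1)$ if for every $X_f\in SU(1,1)$ there exist a control $u$ and a time $T\ge 0$ with $X(T)=X_f$. An abnormal extremal is a control $u$ on $[0,T]$ with trajectory $X$ for which there exists a nonzero constant matrix $S\in su(1,1)$ such that for almost every $t$ the function $v\mapsto \langle S, X(t)^{-1}[A+vB]X(t)\rangle$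 is minimized over $v\in\mathbb{R}$ at $v=u(t)$ (this is the maximum principle condition with Hamiltonian $\langle S,X^{-1}[A+uB]X\rangle+\frac12\lambda_0u^2$ and multiplier $\lambda_0=0$). *)

(* Defs.v *)
(* mathcomp-analysis (Lebesgue integral) + real-closed complex numbers. *)
From HB Require Import structures.
From mathcomp Require Import all_boot all_order all_algebra.
From mathcomp Require Import complex.
From mathcomp Require Import all_classical all_reals all_analysis.

Set Implicit Arguments.
Unset Strict Implicit.
Unset Printing Implicit Defensive.

Import Order.TTheory GRing.Theory Num.Theory.
Local Open Scope ring_scope.
Local Open Scope complex_scope.
Local Open Scope classical_set_scope.

Section SU11.
Variable R : realType.
Local Notation C := R[i].
Local Notation M2 := 'M[C]_2.

(* the 2x2 matrix [[a, b], [c, d]] *)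
Definition mx2 (a b c d : C) : M2 :=
  \matrix_(k < 2, l < 2)
    if k == 0 :> nat then (if l == 0 :> nat then a else b)
    else (if l == 0 :> nat then c else d).

Definition imC : C := 'i%C.

Definition Kx : M2 := (2^-1 : C) *: mx2 0 (- imC) imC 0.
Definition Ky : M2 := (2^-1 : C) *: mx2 0 (-1) (-1) 0.
Definition Kz : M2 := (2^-1 : C) *: mx2 (- imC) 0 0 imC.

(* conjugate transpose *)
Definition dag (M : M2) : M2 := (map_mx (fun z : C => z^*) M)^T.

(* <M, N> = 2 Tr(M N^dagger) *)
Definition ip (M N : M2) : C := 2 * \tr (M *m dag N).

(* su(1,1): the real span of Kx, Ky, Kz *)
Definition su11 (M : M2) : Prop :=
  exists a b c : R, M = a%:C *: Kx + b%:C *: Ky + c%:C *: Kz.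

(* SU(1,1): special pseudo-unitary matrices, X^dagger J X = J, det X = 1 *)
Definition Jm : M2 := mx2 1 0 0 (-1).
Definition SU11 (X : M2) : Prop := \det X = 1 /\ dag X *m Jm *m X = Jm.

Local Notation mu := (@lebesgue_measure R).

(* admissible control on [0,T]: real-valued, Lebesgue integrable on [0,T]
   (in particular measurable) *)
Definition admissible (u : R -> R) (T : R) : Prop :=
  mu.-integrable `[0, T] (EFin \o u).

(* right-hand side of the control system *)
Definition rhs (A B : M2) (u : R -> R) (X : R -> M2) (s : R) : M2 :=
  (A + (u s)%:C *: B) *m X s.

(* X is the absolutely continuous (Caratheodory) solution on [0,T] of
   dX/dt = [A + u B] X, X(0) = I, i.e. X(t) = I + int_0^t [A + u B] X ds,
   the integral being taken entrywise (real and imaginary parts). *)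
Definition trajectory (A B : M2) (u : R -> R) (T : R) (X : R -> M2) : Prop :=
  X 0 = 1%:M /\
  forall k l : 'I_2,
    mu.-integrable `[0, T] (EFin \o (fun s => complex.Re (rhs A B u X s k l))) /\
    mu.-integrable `[0, T] (EFin \o (fun s => complex.Im (rhs A B u X s k l))) /\
    forall t, 0 <= t <= T ->
      X t k l = (1%:M : M2) k l
                + (Rintegral mu `[0, t] (fun s => complex.Re (rhs A B u X s k l)))%:C
                + imC * (Rintegral mu `[0, t] (fun s => complex.Im (rhs A B u X s k l)))%:C.

(* controllability on SU(1,1) *)
Definition controllable (A B : M2) : Prop :=
  forall Xf : M2, SU11 Xf ->
    exists (u : R -> R) (T : R) (X : R -> M2),
      0 <= T /\ admissible u T /\ trajectory A B u T X /\ X T = Xf.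

(* abnormal extremal on [0,T] (T > 0) with trajectory X *)
Definition abnormal_extremal (A B : M2) (T : R) (u : R -> R) (X : R -> M2) : Prop :=
  0 < T /\ admissible u T /\ trajectory A B u T X /\
  exists S : M2, su11 S /\ S <> 0 /\
    {ae mu, forall t, t \in `[0, T] -> forall v : R,
       ip S (invmx (X t) *m (A + (u t)%:C *: B) *m X t)
       <= ip S (invmx (X t) *m (A + v%:C *: B) *m X t)}.

End SU11.

(* Main.v *)
(* If u is abnormal, the affine function of v has zero slope, i.e. tr(B P) = 0 almost
   everywhere, where P = X S^dagger X^-1 solves P' = [A + u B, P].  Differentiating twice,
   tr([B, A] P) = 0 and tr([[B, A], A + u B] P) = 0, and the latter is
   -2 tr(A P) (tr(A B) + u tr(B^2)) by the double bracket formula in sl(2).  When the Gram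
   determinant tr(A^2) tr(B^2) - tr(A B)^2 does not vanish, A, B and [B, A] are independent, so
   tr(A P) <> 0 and tr(A B) + u tr(B^2) = 0 almost everywhere.  When it vanishes, A and B have
   a common left eigenvector, which spans a line invariant under all reachable matrices; no
   line is invariant under SU(1,1), so the system is not controllable. *)

Require Import Defs.
From HB Require Import structures.
From mathcomp Require Import all_boot all_order all_algebra.
From mathcomp Require Import complex.
From mathcomp Require Import all_classical all_reals all_analysis.
From mathcomp Require Import measurable_realfun ring lra.

Set Implicit Arguments.
Unset Strict Implicit.
Unset Printing Implicit Defensive.

Import Order.TTheory GRing.Theory Num.Theory.
Import numFieldNormedType.Exports.
Local Open Scope ring_scope.
Local Open Scope complex_scope.
Local Open Scope classical_set_scope.

(** * Fubini on the half-plane below the diagonal order *)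

Section Fubini.
Variable R : realType.
Notation mu := (@lebesgue_measure R).

(** Both sides integrate [p s * q r] over the half-plane [s <= r], in the two orders. This is the
    source of integration by parts for absolutely continuous functions. *)
Lemma Rintegral_triangle (p q : R -> R) :
  mu.-integrable setT (EFin \o p) -> mu.-integrable setT (EFin \o q) ->
  \int[mu]_s (p s * \int[mu]_(r in `[s, +oo[) q r) =
  \int[mu]_r (q r * \int[mu]_(s in `]-oo, r]) p s).
Proof.
move=> ip iq.
have mp : measurable_fun setT p by apply/measurable_EFinP; case/integrableP: ip.
have mq : measurable_fun setT q by apply/measurable_EFinP; case/integrableP: iq.
pose K (z : R * R) : \bar R := (if z.1 <= z.2 then p z.1 * q z.2 else 0)%:E.
have mK : measurable_fun setT K.
  apply/measurable_EFinP; apply: measurable_fun_ifT => //.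
    exact: measurable_fun_ler.
  by apply: measurable_funM; apply: measurableT_comp.
have iK : (mu \x mu)%E.-integrable setT K.
  apply/integrable12ltyP => //.
  (* Dropping the constraint [x <= y] bounds the inner integral by [|p x|] times the norm of [q], so
     the iterated integral of [|K|] is finite and [K] is integrable on the plane. *)
  have bnd x : (\int[mu]_y `|K (x, y)| <= `|p x|%:E * \int[mu]_y `|(q y)%:E|)%E.
    rewrite -ge0_integralZl//; last first.
      by apply: measurableT_comp => //; exact/measurable_EFinP.
    apply: ge0_le_integral => //.
    - by apply: measurableT_comp => //; apply: (measurableT_comp mK); exact: measurable_pair1.
    - by apply: measurable_funeM; apply: measurableT_comp => //; exact/measurable_EFinP.
    - move=> y _; rewrite /K/=; case: ifP => _; rewrite -EFinM lee_fin ?normrM//.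
      by rewrite normr0 mulr_ge0.
  have /integrableP[_ qoo] := iq; have /integrableP[_ poo] := ip.
  have qfin : (\int[mu]_y `|(q y)%:E|)%E \is a fin_num.
    by rewrite ge0_fin_numE//; apply: integral_ge0.
  apply: (@le_lt_trans _ _ (\int[mu]_x (`|p x|%:E * \int[mu]_y `|(q y)%:E|))%E).
    apply: ge0_le_integral => //.
    - move=> x _; exact: integral_ge0.
    - apply: (@measurable_fun_fubini_tonelli_F _ _ _ _ _ mu (abse \o K)) => //=.
      exact: measurableT_comp.
    - by apply: emeasurable_funM => //; apply/measurable_EFinP; apply: measurableT_comp.
  rewrite ge0_integralZr//=.
  - by apply: lte_mul_pinfty => //; [exact: integral_ge0|rewrite ge0_fin_numE//; exact: integral_ge0].
  - by apply/measurable_EFinP; apply: measurableT_comp.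
  - exact: integral_ge0.
(* Rewrites a scaled real integral over [D] as an extended-real integral over the whole line, the
   shape of the sections of [K]. *)
have intP (h : R -> R) (D : set R) : measurable D ->
    mu.-integrable setT (EFin \o h) -> forall k,
    (k * \int[mu]_(r in D) h r)%:E =
    (\int[mu]_r if r \in D then (k * h r)%:E else 0%E)%E.
  move=> mD ih k; have ihD : mu.-integrable D (EFin \o h) by apply: integrableS ih.
  rewrite EFinM /Rintegral fineK; last exact: integrable_fin_num.
  by rewrite -integralZl// integral_mkcond; apply: eq_integral => y _; rewrite patchE.
rewrite /Rintegral; congr fine.
transitivity (\int[mu]_x \int[mu]_y K (x, y))%E.
  apply: eq_integral => x _; rewrite intP//; apply: eq_integral => y _.
  rewrite /K/=; case: ifPn => xy.
    by move: xy; rewrite inE/= in_itv/= andbT => ->.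
  by move: xy; rewrite notin_setE/= in_itv/= andbT => /negP/negbTE ->.
rewrite Fubini//; apply: eq_integral => y _; rewrite intP//.
apply: eq_integral => x _; rewrite /K/= mulrC.
case: ifPn => [|/negbTE] xy; first by rewrite mem_set//= in_itv.
by rewrite memNset//= in_itv/= xy.
Qed.
End Fubini.

(** * Calculus of absolutely continuous real functions *)

Section Primitive.
Variable R : realType.
Notation mu := (@lebesgue_measure R).
Implicit Types (T : R) (F G f g : R -> R).

(* [F] is absolutely continuous on [0, T] with almost everywhere derivative [f]. *)
Definition primitive T F f :=
  mu.-integrable `[0, T] (EFin \o f) /\
  forall t, 0 <= t <= T -> F t = F 0 + \int[mu]_(s in `[0, t]) f s.

Lemma integrable_addr T f g : mu.-integrable `[0, T] (EFin \o f) ->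
  mu.-integrable `[0, T] (EFin \o g) ->
  mu.-integrable `[0, T] (EFin \o (fun t => f t + g t)).
Proof.
move=> fi gi; apply: (@eq_integrable _ _ _ mu _ _ ((EFin \o f) \+ (EFin \o g))%E) => //.
exact: integrableD.
Qed.

Lemma integrable_mulr T f c : mu.-integrable `[0, T] (EFin \o f) ->
  mu.-integrable `[0, T] (EFin \o (fun t => c * f t)).
Proof.
move=> fi; apply: (@eq_integrable _ _ _ mu _ _ (fun t => c%:E * (EFin \o f) t)%E) => //.
exact: integrableZl.
Qed.

Lemma integrable_init T f t : mu.-integrable `[0, T] (EFin \o f) ->
  t <= T -> mu.-integrable `[0, t] (EFin \o f).
Proof.
move=> fi tT; apply: integrableS fi => //.
by apply: subset_itvl; rewrite bnd_simp.
Qed.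

Lemma integrable_normr T f : mu.-integrable `[0, T] (EFin \o f) ->
  mu.-integrable `[0, T] (EFin \o (fun t => `|f t|)).
Proof. by move=> /integrable_abse; exact: eq_integrable. Qed.

Lemma ler_Rintegral_init T f t : mu.-integrable `[0, T] (EFin \o f) -> t <= T ->
  (forall x, 0 <= f x) ->
  \int[mu]_(s in `[0, t]) f s <= \int[mu]_(s in `[0, T]) f s.
Proof.
move=> fi tT f0; rewrite /Rintegral fine_le//.
- by apply: integrable_fin_num => //; exact: (integrable_init fi tT).
- exact: integrable_fin_num.
- apply: ge0_subset_integral => //.
  + by case/integrableP: fi.
  + by move=> x _; rewrite lee_fin.
  + by apply: subset_itvl; rewrite bnd_simp.
Qed.

Lemma primitive_continuous T F f : 0 <= T -> primitive T F f ->
  {within `[0, T], continuous F}.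
Proof.
move=> T0 [fi FE].
have := parameterized_integral_continuous T0 fi.
move=> /(fun h x => continuousD (@cst_continuous _ _ (F 0) x) (h x)).
apply: subspace_eq_continuous => x.
rewrite inE/= in_itv/= => x0T; exact/esym/FE.
Qed.

Lemma primitive_measurable T F f : 0 <= T -> primitive T F f ->
  measurable_fun `[0, T] F.
Proof.
by move=> T0 /primitive_continuous-/(_ T0); exact: subspace_continuous_measurable_fun.
Qed.

Lemma primitive_bounded T F f : primitive T F f ->
  [bounded F x | x in (`[0, T] : set R)].
Proof.
move=> [fi FE]; exists (`|F 0| + \int[mu]_(s in `[0, T]) `|f s|); split; first exact: num_real.
move=> M /ltW MF x /=; rewrite in_itv/= => x0T; have /andP[_ xT] := x0T.
apply: le_trans MF; rewrite FE//; apply: (le_trans (ler_normD _ _)); rewrite lerD2l.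
apply: (le_trans (le_normr_Rintegral _ _)) => //; first exact: integrable_init fi xT.
exact: ler_Rintegral_init (integrable_normr fi) xT _.
Qed.

Lemma primitive_cst T F c : (forall t, 0 <= t <= T -> F t = c) ->
  primitive T F (cst 0).
Proof.
move=> Fc; split; first exact: integrable0.
move=> t t0T; rewrite !Fc//.
  by rewrite Rintegral_cst// mul0r addr0.
by case/andP: t0T => t0 tT; rewrite lexx (le_trans t0).
Qed.

Lemma primitiveD T F G f g : primitive T F f -> primitive T G g ->
  primitive T (fun t => F t + G t) (fun t => f t + g t).
Proof.
move=> [fi FE] [gi GE]; split; first exact: integrable_addr.
move=> t t0T; have /andP[_ tT] := t0T; rewrite FE// GE// RintegralD//.
- by rewrite addrACA.
- exact: integrable_init fi tT.
- exact: integrable_init gi tT.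
Qed.

Lemma primitiveZ T F f c : primitive T F f ->
  primitive T (fun t => c * F t) (fun t => c * f t).
Proof.
move=> [fi FE]; split; first exact: integrable_mulr.
move=> t t0T; have /andP[_ tT] := t0T.
by rewrite FE// mulrDr RintegralZl//; exact: integrable_init fi tT.
Qed.

Lemma eq_primitive T F G f g :
  (forall t, 0 <= t <= T -> F t = G t) -> (forall t, 0 <= t <= T -> f t = g t) ->
  primitive T F f -> primitive T G g.
Proof.
move=> FG fg [fi FE]; split.
  by apply: eq_integrable fi => // x; rewrite inE/= in_itv/= => /fg ->.
move=> t t0T; have /andP[t0 tT] := t0T.
have T0 : 0 <= (0 : R) <= T by rewrite lexx (le_trans t0).
rewrite -(FG _ t0T) -(FG _ T0) (FE _ t0T).
congr (_ + _); apply: eq_Rintegral => x; rewrite inE/= in_itv/= => /andP[x0 xt].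
by rewrite fg// x0 (le_trans xt).
Qed.

Lemma integrable_mul_primitive T F f g : 0 <= T -> primitive T F f ->
  mu.-integrable `[0, T] (EFin \o g) ->
  mu.-integrable `[0, T] (EFin \o (fun t => g t * F t)).
Proof.
move=> T0 Ff gi.
exact: (integrableMl _ gi (primitive_measurable T0 Ff) (primitive_bounded Ff)).
Qed.

Lemma Rintegral_itv_tail f (t s : R) : mu.-integrable `[0, t] (EFin \o f) ->
  0 <= s <= t ->
  \int[mu]_(r in `[s, t]) f r =
  \int[mu]_(r in `[0, t]) f r - \int[mu]_(r in `[0, s]) f r.
Proof.
move=> fi /andP[s0 st]; rewrite (@Rintegral_itvB _ _ _ _ s)// ?bnd_simp//.
rewrite Rintegral_itv_obnd_cbnd//; apply: integrableS fi => //.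
by apply: subset_itvr; rewrite bnd_simp.
Qed.

(** The product is the integral of [p s * q r] over the square of side [t], which the diagonal cuts
    into two triangles, one for each term on the right. *)
Lemma Rintegral_mul (p q : R -> R) (t : R) : 0 <= t ->
  mu.-integrable `[0, t] (EFin \o p) -> mu.-integrable `[0, t] (EFin \o q) ->
  (\int[mu]_(s in `[0, t]) p s) * (\int[mu]_(s in `[0, t]) q s) =
  \int[mu]_(s in `[0, t]) (p s * (\int[mu]_(r in `[0, s]) q r)
                         + q s * (\int[mu]_(r in `[0, s]) p r)).
Proof.
move=> t0 ip iq.
have prim h : mu.-integrable `[0, t] (EFin \o h) ->
    primitive t (fun s => \int[mu]_(r in `[0, s]) h r) h.
  by move=> ih; split => // s _; rewrite set_itv1 Rintegral_set1 add0r.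
(* Extending [p] and [q] by zero outside [[0, t]] turns the half-plane identity into one on a
   triangle. *)
have restr h : mu.-integrable `[0, t] (EFin \o h) ->
    mu.-integrable setT (EFin \o (h \_ `[0, t])).
  by move=> /integrable_mkcond; rewrite restrict_EFin; apply.
have := @Rintegral_triangle R (p \_ `[0, t]) (q \_ `[0, t]) (restr _ ip) (restr _ iq).
have -> : \int[mu]_s ((p \_ `[0, t]) s * \int[mu]_(r in `[s, +oo[) (q \_ `[0, t]) r) =
    \int[mu]_(s in `[0, t]) (p s * (\int[mu]_(r in `[0, t]) q r -
                                    \int[mu]_(r in `[0, s]) q r)).
  rewrite [RHS]Rintegral_mkcond; apply: eq_Rintegral => s _; rewrite !patchE.
  case: ifPn => [|_]; last by rewrite mul0r.
  rewrite inE/= in_itv/= => s0t; have /andP[s0 st] := s0t.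
  rewrite -Rintegral_itv_tail// -Rintegral_mkcondr; congr (_ * Rintegral _ _ _).
  apply/seteqP; split => x /=; rewrite !in_itv/= ?andbT; first by move=> [-> /andP[]].
  by move=> /andP[sx ->]; rewrite sx (le_trans s0).
have -> : \int[mu]_r ((q \_ `[0, t]) r * \int[mu]_(s in `]-oo, r]) (p \_ `[0, t]) s) =
    \int[mu]_(r in `[0, t]) (q r * \int[mu]_(s in `[0, r]) p s).
  rewrite [RHS]Rintegral_mkcond; apply: eq_Rintegral => s _; rewrite !patchE.
  case: ifPn => [|_]; last by rewrite mul0r.
  rewrite inE/= in_itv/= => s0t; have /andP[s0 st] := s0t.
  rewrite -Rintegral_mkcondr; congr (_ * Rintegral _ _ _).
  apply/seteqP; split => x /=; rewrite !in_itv/= ?andbT.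
    by move=> [-> /andP[->]].
  by move=> /andP[-> xs]; split => //; rewrite (le_trans xs).
have ipq := integrable_mul_primitive t0 (prim _ iq) ip.
have iqp := integrable_mul_primitive t0 (prim _ ip) iq.
(* The triangle identity replaces the second term by the integral of [p s] times the tail of [q] on
   [[s, t]]; head and tail then add up to the full integral of [q]. *)
rewrite RintegralD// => <-.
under [X in _ + X]eq_Rintegral do rewrite mulrBr.
rewrite RintegralB//; last first.
  apply: eq_integrable (integrable_mulr (\int[mu]_(r in `[0, t]) q r) ip) => // x _.
  by rewrite /= mulrC.
by rewrite RintegralZr// addrC subrK.
Qed.

(** Product rule: writing [F] and [G] as initial value plus integral, [Rintegral_mul] handles the
    product of the integrals, and the terms in [F 0] and [G 0] are linear. *)
Lemma primitiveM T F G f g : 0 <= T -> primitive T F f -> primitive T G g ->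
  primitive T (fun t => F t * G t) (fun t => f t * G t + F t * g t).
Proof.
move=> T0 Ff Gg; have [fi FE] := Ff; have [gi GE] := Gg.
have ifG := integrable_mul_primitive T0 Gg fi.
have igF := integrable_mul_primitive T0 Ff gi.
split.
  apply: integrable_addr => //; apply: eq_integrable igF => // x _.
  by rewrite /= mulrC.
move=> t t0T; have /andP[t0 tT] := t0T.
have fti := integrable_init fi tT; have gti := integrable_init gi tT.
have prim h : mu.-integrable `[0, t] (EFin \o h) ->
    primitive t (fun s => \int[mu]_(r in `[0, s]) h r) h.
  by move=> ih; split => // s _; rewrite set_itv1 Rintegral_set1 add0r.
have i1 := integrable_mul_primitive t0 (prim _ gti) fti.
have i2 := integrable_mul_primitive t0 (prim _ fti) gti.
have -> : \int[mu]_(s in `[0, t]) (f s * G s + F s * g s) =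
  \int[mu]_(s in `[0, t]) ((f s * (\int[mu]_(r in `[0, s]) g r)
                          + g s * (\int[mu]_(r in `[0, s]) f r)) +
  (G 0 * f s + F 0 * g s)).
  apply: eq_Rintegral => s; rewrite inE/= in_itv/= => /andP[s0 st].
  have sT : 0 <= s <= T by rewrite s0 (le_trans st).
  by rewrite (FE _ sT) (GE _ sT); ring.
have fZ := integrable_mulr (G 0) fti; have gZ := integrable_mulr (F 0) gti.
rewrite RintegralD//; [|exact: integrable_addr..].
by rewrite -Rintegral_mul// RintegralD// !RintegralZl//= (FE _ t0T) (GE _ t0T); ring.
Qed.

Lemma primitiveX T F f n : 0 <= T -> primitive T F f ->
  primitive T (fun t => F t ^+ n.+1) (fun t => n.+1%:R * (f t * F t ^+ n)).
Proof.
move=> T0 Ff; elim: n => [|n IH].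
  by apply: eq_primitive Ff => t _; rewrite ?expr1// expr0 mulr1 mul1r.
apply: eq_primitive (primitiveM T0 Ff IH) => t _; first by rewrite -exprS.
by rewrite (exprS (F t)) -[n.+2]addn1 natrD; ring.
Qed.

(* With [K t] the integral of [|k|] on [0, t] and [M] that of [|k F|] on [0, T], induction
   gives [|F t| <= M K(t)^n / n!]. *)
Lemma linear_primitive_eq0 T F k : 0 <= T -> F 0 = 0 ->
  mu.-integrable `[0, T] (EFin \o k) ->
  primitive T F (fun t => k t * F t) ->
  forall t, 0 <= t <= T -> F t = 0.
Proof.
move=> T0 F0 ki [kFi FE].
pose K t := \int[mu]_(s in `[0, t]) `|k s|.
have K0 : K 0 = 0 by rewrite /K set_itv1 Rintegral_set1.
have Kp : primitive T K (fun t => `|k t|).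
  by split; [exact: integrable_normr|move=> t _; rewrite K0 add0r].
pose M := \int[mu]_(s in `[0, T]) `|k s * F s|.
have aki := integrable_normr kFi.
have Fle t : 0 <= t <= T -> `|F t| <= \int[mu]_(s in `[0, t]) `|k s * F s|.
  move=> t0T; have /andP[_ tT] := t0T; rewrite FE// F0 add0r.
  by apply: le_normr_Rintegral => //; exact: (integrable_init kFi tT).
have bound n : forall t, 0 <= t <= T -> `|F t| <= M * (K t ^+ n / n`!%:R).
  elim: n => [|n IH] t t0T; have /andP[t0 tT] := t0T.
    rewrite fact0 expr0 divr1 mulr1; apply: le_trans (Fle _ t0T) _.
    by apply: ler_Rintegral_init.
  apply: le_trans (Fle _ t0T) _.
  have [Ki KE] := primitiveX n T0 Kp.
  have Kti := integrable_init Ki tT.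
  (* Since [K 0 = 0], the power [K t ^+ n.+1] is the integral of its derivative, so the bound
     reduces to a comparison of integrands, where the induction hypothesis applies. *)
  have -> : M * (K t ^+ n.+1 / n.+1`!%:R) =
    \int[mu]_(s in `[0, t]) (M / n.+1`!%:R * (n.+1%:R * (`|k s| * K s ^+ n))).
    by rewrite RintegralZl// KE// K0 expr0n/= add0r; ring.
  apply: le_Rintegral => //; [exact: (integrable_init aki tT)|exact: integrable_mulr|].
  move=> s /=; rewrite in_itv/= => /andP[s0 st].
  have sT : 0 <= s <= T by rewrite s0 (le_trans st).
  rewrite normrM; apply: le_trans (ler_wpM2l (normr_ge0 _) (IH _ sT)) _.
  have n1 : n.+1%:R != 0 :> R by rewrite pnatr_eq0.
  rewrite factS natrM invfM le_eqVlt; apply/orP; left; apply/eqP.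
  transitivity (M / n`!%:R * `|k s| * K s ^+ n * (n.+1%:R^-1 * n.+1%:R)).
    by rewrite mulVf//; ring.
  by set a := n.+1%:R; set b := a^-1; ring.
move=> t t0T; apply/eqP; rewrite -normr_le0.
(* The bounds are multiples of the terms of the exponential series at [K t], which tend to 0. *)
have cv : M * exp_coeff (K t) n @[n --> \oo] --> M * 0.
  by apply: cvgMr; exact: cvg_exp_coeff.
rewrite -(mulr0 M) -(cvg_lim (@Rhausdorff R) cv).
apply: limr_ge; first by apply/cvg_ex; exists (M * 0).
by apply: nearW => n; exact: bound.
Qed.

(** An interval of positive length is not contained in a null set. *)
Lemma ae_itv_exists T (P : R -> Prop) : 0 < T ->
  {ae mu, forall t, t \in `[0, T] -> P t} -> exists2 t, 0 <= t <= T & P t.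
Proof.
move=> T0 [N [mN N0 NP]]; apply: contrapT => noP.
have sub : `[0, T] `<=` N.
  move=> t /=; rewrite in_itv/= => t0T; apply: NP => /= Pt; apply: noP.
  by exists t => //; apply: Pt; rewrite inE/= in_itv.
have : (mu `[0%R, T] <= mu N)%E by apply: le_measure; rewrite ?inE.
by rewrite N0 lebesgue_measure_itv/= lte_fin T0 oppr0 adde0 lee_fin leNgt T0.
Qed.

Lemma Rintegral_ae0 T f t : mu.-integrable `[0, T] (EFin \o f) -> t <= T ->
  {ae mu, forall s, s \in `[0, T] -> f s = 0} ->
  \int[mu]_(s in `[0, t]) f s = 0.
Proof.
move=> fi tT f0.
rewrite /Rintegral (_ : (\int[mu]_(s in _) _)%E = \int[mu]_(s in `[0%R, t]) 0)%E.
  by rewrite integral0.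
apply: ae_eq_integral => //.
  by case/integrableP: (integrable_init fi tT).
move: f0; apply: filterS; first exact: (ae_filter_ringOfSetsType mu).
move=> s /= fs0 st; rewrite fs0// inE/=.
by move: st; rewrite /= !in_itv/= => /andP[-> /le_trans]; apply.
Qed.

(* [F^2] is a primitive of [2 F f], which vanishes almost everywhere, so it is constant. *)
Lemma primitive_ae0 T F f : 0 < T -> primitive T F f ->
  {ae mu, forall t, t \in `[0, T] -> F t = 0} ->
  (forall t, 0 <= t <= T -> F t = 0) /\
  {ae mu, forall t, t \in `[0, T] -> f t = 0}.
Proof.
move=> T0 Ff F0; have T0' := ltW T0.
have Feq0 t : 0 <= t <= T -> F t = 0.
  have [i2 E2] := primitiveM T0' Ff Ff.
  have sq s : 0 <= s <= T -> F s * F s = F 0 * F 0.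
    move=> s0T; have /andP[_ sT] := s0T.
    rewrite E2// (@Rintegral_ae0 T) ?addr0//.
    move: F0; apply: filterS; first exact: (ae_filter_ringOfSetsType mu).
    by move=> x /= Fx xT; rewrite Fx// mulr0 mul0r addr0.
  (* One zero of [F] identifies the constant value of [F^2] as 0. *)
  have [s s0T Fs] := ae_itv_exists T0 F0.
  move=> t0T; apply/eqP; rewrite -[_ == 0]orbb -mulf_eq0 sq// -(sq s)// Fs.
  by rewrite mul0r.
split => //; have [fi FE] := Ff.
pose g := f \_ `[0, T].
have gi : mu.-integrable setT (EFin \o g).
  by move/integrable_mkcond : fi; rewrite restrict_EFin; apply.
(* Integrating from -1 instead of 0 makes [FTC1] applicable at t = 0. *)
have Phi0 x : \int[mu]_(s in `[(-1), x]) g s = 0.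
  rewrite -Rintegral_mkcondr.
  have [x0|x0] := ltP x 0.
    rewrite (_ : _ `&` _ = set0) ?Rintegral_set0//; apply/seteqP; split => // s /=.
    by rewrite !in_itv/= => -[/andP[_ sx] /andP[s0 _]]; lra.
  (* [g] vanishes outside [[0, T]], so the integral effectively runs from 0 to the minimum of [x]
     and [T]. *)
  have mxT : 0 <= Num.min x T <= T by rewrite le_min x0 T0' ge_min lexx orbT.
  have -> : (`[(-1), x] `&` `[0, T] = `[0, Num.min x T] :> set R)%classic; last first.
    by have := FE _ mxT; rewrite !Feq0 ?lexx//= add0r => <-.
  apply/seteqP; split => s /=; rewrite !in_itv/= le_min.
    by move=> [/andP[_ ->] /andP[-> ->]].
  by move=> /andP[s0 /andP[-> ->]]; rewrite s0 (le_trans _ s0).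
(* Lebesgue differentiation: almost everywhere [g] is the derivative of its indefinite integral,
   which is identically zero. *)
have := @FTC1 R g (BLeft (-1)).
have gy y : mu.-integrable `[(-1), y] (EFin \o g) by apply: integrableS gi.
have gl : locally_integrable setT g by apply: integrable_locally.
move=> /(_ gy gl).
apply: filterS; first exact: (ae_filter_ringOfSetsType mu).
move=> x /= H; rewrite inE/= in_itv/= => x0T; have /andP[x0 xT] := x0T.
have [|_] := H; first by rewrite lte_fin (lt_le_trans _ x0).
rewrite /g patchE mem_set ?in_itv//= => <-.
by rewrite (_ : (fun _ => _) = cst 0) ?derive1_cst//; apply/funext => y; rewrite Phi0.
Qed.
End Primitive.

(** * The same calculus for complex and matrix-valued functions *)

Section ComplexPrimitive.
Variable R : realType.
Notation mu := (@lebesgue_measure R).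
Notation C := R[i].
Notation Re := (@complex.Re R).
Notation Im := (@complex.Im R).
Variables (T : R) (T0 : 0 <= T).
Implicit Types (F G f g : R -> C).

Definition cprimitive F f :=
  primitive T (Re \o F) (Re \o f) /\ primitive T (Im \o F) (Im \o f).

Lemma eq_cprimitive F G f g :
  (forall t, 0 <= t <= T -> F t = G t) -> (forall t, 0 <= t <= T -> f t = g t) ->
  cprimitive F f -> cprimitive G g.
Proof.
by move=> FG fg [rF iF]; split; [apply: eq_primitive rF|apply: eq_primitive iF]
  => t t0T /=; rewrite ?(FG _ t0T)// (fg _ t0T).
Qed.

Lemma cprimitive_cst (c : C) : cprimitive (cst c) (cst 0).
Proof. by split; [apply: (primitive_cst (c := Re c))|apply: (primitive_cst (c := Im c))]. Qed.

Lemma cprimitiveD F G f g : cprimitive F f -> cprimitive G g ->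
  cprimitive (fun t => F t + G t) (fun t => f t + g t).
Proof.
move=> [rF iF] [rG iG]; split.
  by apply: eq_primitive (primitiveD rF rG) => t _ /=; rewrite raddfD.
by apply: eq_primitive (primitiveD iF iG) => t _ /=; rewrite raddfD.
Qed.

Lemma cprimitive_sum (I : Type) (r : seq I) (F f : I -> R -> C) :
  (forall i, cprimitive (F i) (f i)) ->
  cprimitive (fun t => \sum_(i <- r) F i t) (fun t => \sum_(i <- r) f i t).
Proof.
move=> Ff; elim: r => [|i r IH].
  by apply: eq_cprimitive (cprimitive_cst 0) => t _; rewrite big_nil.
by apply: eq_cprimitive (cprimitiveD (Ff i) IH) => t _; rewrite big_cons.
Qed.

Lemma ReM (x y : C) : Re (x * y) = Re x * Re y - Im x * Im y.
Proof. by case: x y => [a b] [c d]. Qed.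

Lemma ImM (x y : C) : Im (x * y) = Re x * Im y + Im x * Re y.
Proof. by case: x y => [a b] [c d]. Qed.

Lemma cprimitiveM F G f g : cprimitive F f -> cprimitive G g ->
  cprimitive (fun t => F t * G t) (fun t => f t * G t + F t * g t).
Proof.
move=> [rF iF] [rG iG].
have rr := primitiveM T0 rF rG; have ii := primitiveM T0 iF iG.
have ri := primitiveM T0 rF iG; have ir := primitiveM T0 iF rG.
split.
  apply: eq_primitive (primitiveD rr (primitiveZ (-1) ii)) => t _ /=.
    by rewrite ReM; ring.
  by rewrite raddfD/= !ReM; ring.
apply: eq_primitive (primitiveD ri ir) => t _ /=.
  by rewrite ImM; ring.
by rewrite raddfD/= !ImM; ring.
Qed.

Lemma cprimitiveZ F f c : cprimitive F f ->
  cprimitive (fun t => c * F t) (fun t => c * f t).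
Proof.
move=> Ff; apply: eq_cprimitive (cprimitiveM (cprimitive_cst c) Ff) => t _ //.
by rewrite mul0r add0r.
Qed.

Lemma cprimitive0 F : cprimitive F (cst 0) -> forall t, 0 <= t <= T -> F t = F 0.
Proof.
move=> [[_ rF] [_ iF]] t t0T; apply/eqP; rewrite eq_complex.
have := rF _ t0T; have := iF _ t0T; rewrite /= !Rintegral_cst// !mul0r !addr0.
by move=> -> ->; rewrite !eqxx.
Qed.

(** The squared modulus of [F] solves the real linear equation with coefficient [2 * Re k], so the
    real uniqueness result applies to it. *)
Lemma linear_cprimitive_eq0 F (k : R -> C) : F 0 = 0 ->
  mu.-integrable `[0, T] (EFin \o (Re \o k)) ->
  cprimitive F (fun t => k t * F t) ->
  forall t, 0 <= t <= T -> F t = 0.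
Proof.
move=> F0 ki [rF iF] t t0T.
have rr := primitiveM T0 rF rF; have ii := primitiveM T0 iF iF.
have sq : primitive T (fun t => Re (F t) ^+ 2 + Im (F t) ^+ 2)
    (fun t => 2 * Re (k t) * (Re (F t) ^+ 2 + Im (F t) ^+ 2)).
  apply: eq_primitive (primitiveD rr ii) => s _ /=.
    by rewrite !expr2.
  by rewrite ReM ImM; ring.
have := linear_primitive_eq0 T0 _ _ sq t0T.
rewrite F0/= expr0n/= addr0 => /(_ erefl (integrable_mulr 2 ki))/eqP.
rewrite paddr_eq0 ?sqr_ge0// !sqrf_eq0 => /andP[/eqP r0 /eqP i0].
by apply/eqP; rewrite eq_complex r0 i0 !eqxx.
Qed.

Lemma cprimitive_ae0 F f : 0 < T -> cprimitive F f ->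
  {ae mu, forall t, t \in `[0, T] -> F t = 0} ->
  (forall t, 0 <= t <= T -> F t = 0) /\
  {ae mu, forall t, t \in `[0, T] -> f t = 0}.
Proof.
move=> Tp [rF iF] F0.
have [] := primitive_ae0 Tp rF.
  move: F0; apply: filterS; first exact: (ae_filter_ringOfSetsType mu).
  by move=> t /= Ft tT; rewrite Ft.
move=> rF0 rf0; have [] := primitive_ae0 Tp iF.
  move: F0; apply: filterS; first exact: (ae_filter_ringOfSetsType mu).
  by move=> t /= Ft tT; rewrite Ft.
move=> iF0 if0; split.
  by move=> t t0T; apply/eqP; rewrite eq_complex; apply/andP; split; apply/eqP;
    [exact: rF0|exact: iF0].
move: rf0 if0; apply: filterS2; first exact: (ae_filter_ringOfSetsType mu).
move=> t /= r0 i0 tT; apply/eqP; rewrite eq_complex; apply/andP; split; apply/eqP;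
  [exact: r0|exact: i0].
Qed.

Definition mxprimitive m n (X F : R -> 'M[C]_(m, n)) :=
  forall i j, cprimitive (fun t => X t i j) (fun t => F t i j).

Lemma mxprimitive_cst m n (A : 'M[C]_(m, n)) : mxprimitive (cst A) (cst 0).
Proof.
by move=> i j; apply: eq_cprimitive (cprimitive_cst (A i j)) => t _ //=; rewrite mxE.
Qed.

Lemma mxprimitiveM m n p (X F : R -> 'M[C]_(m, n)) (Y G : R -> 'M[C]_(n, p)) :
  mxprimitive X F -> mxprimitive Y G ->
  mxprimitive (fun t => X t *m Y t) (fun t => F t *m Y t + X t *m G t).
Proof.
move=> XF YG i j.
apply: eq_cprimitive (cprimitive_sum (index_enum 'I_n)
   (fun l => cprimitiveM (XF i l) (YG l j))) => t _; first by rewrite !mxE.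
by rewrite !mxE big_split.
Qed.

Lemma mxprimitiveMl m n p (A : 'M[C]_(m, n)) (X F : R -> 'M[C]_(n, p)) :
  mxprimitive X F ->
  mxprimitive (fun t => A *m X t) (fun t => A *m F t).
Proof.
move=> XF i j; apply: eq_cprimitive (mxprimitiveM (mxprimitive_cst A) XF i j)
  => t _ //.
by rewrite mul0mx add0r.
Qed.

Lemma mxprimitiveMr m n p (A : 'M[C]_(n, p)) (X F : R -> 'M[C]_(m, n)) :
  mxprimitive X F ->
  mxprimitive (fun t => X t *m A) (fun t => F t *m A).
Proof.
move=> XF i j; apply: eq_cprimitive (mxprimitiveM XF (mxprimitive_cst A) i j)
  => t _ //.
by rewrite mulmx0 addr0.
Qed.

Lemma cprimitive_mxtrace n (X F : R -> 'M[C]_n) : mxprimitive X F ->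
  cprimitive (fun t => \tr (X t)) (fun t => \tr (F t)).
Proof. by move=> XF; apply: cprimitive_sum => i; exact: XF. Qed.

Lemma trajectory_mxprimitive (A B : 'M[C]_2) u X : trajectory A B u T X ->
  mxprimitive X (rhs A B u X).
Proof.
move=> [X0 XE] i j; have [ri [ii E]] := XE i j.
split; split=> // t t0T /=; rewrite E// X0; case: (1%:M i j) => a b /=; ring.
Qed.

End ComplexPrimitive.

(** * Identities for traceless 2x2 matrices *)

Section Sl2.
Variable F : comNzRingType.
Implicit Types (A B P X : 'M[F]_2).

Lemma ord2P (P : 'I_2 -> Prop) : P 0 -> P 1 -> forall i, P i.
Proof.
move=> P0 P1 [[|[|//]] i2]; first by rewrite (_ : Ordinal _ = 0)//; exact: val_inj.
by rewrite (_ : Ordinal _ = 1)//; exact: val_inj.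
Qed.

Lemma sum_ord2 (V : nmodType) (f : 'I_2 -> V) : \sum_i f i = f 0 + f 1.
Proof.
by rewrite big_ord_recl big_ord1; congr (_ + f _); exact: val_inj.
Qed.

Lemma mxtrace2 A : \tr A = A 0 0 + A 1 1.
Proof. exact: sum_ord2. Qed.

Lemma det2 A : \det A = A 0 0 * A 1 1 - A 0 1 * A 1 0.
Proof.
rewrite (expand_det_row _ 0) sum_ord2 /cofactor !det_mx11 !mxE /=.
have -> : lift 0 0 = 1 :> 'I_2 by exact: val_inj.
have -> : lift 1 0 = 0 :> 'I_2 by exact: val_inj.
by rewrite /= ?add0n ?expr0 ?expr1; ring.
Qed.

Lemma traceless2 A : \tr A = 0 -> A 1 1 = - A 0 0.
Proof. by rewrite mxtrace2 => /eqP; rewrite addrC addr_eq0 => /eqP. Qed.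

Definition bracket A B : 'M[F]_2 := A *m B - B *m A.

(** Gram determinant of the pair for the trace form [\tr (M *m N)]. *)
Definition gram A B : F := \tr (A *m A) * \tr (B *m B) - \tr (A *m B) ^+ 2.

(* By Cayley-Hamilton, this is the adjugate. *)
Definition adj2 X : 'M[F]_2 := (\tr X)%:M - X.

Lemma mulmx_adj2 X : X *m adj2 X = (\det X)%:M.
Proof.
apply/matrixP; apply: ord2P; apply: ord2P;
  rewrite /adj2 /gram /bracket !(mxE, sum_ord2, mxtrace2, det2)/=; ring.
Qed.

Lemma mul_adj2mx X : adj2 X *m X = (\det X)%:M.
Proof.
apply/matrixP; apply: ord2P; apply: ord2P;
  rewrite /adj2 /gram /bracket !(mxE, sum_ord2, mxtrace2, det2)/=; ring.
Qed.

(** The adjugate reverses products, and that of a traceless matrix is its opposite. *)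
Lemma adj2_mul X A : \tr A = 0 -> adj2 (A *m X) = - (adj2 X *m A).
Proof.
move=> /traceless2 A11.
apply/matrixP; apply: ord2P; apply: ord2P;
  rewrite /adj2 /gram /bracket !(mxE, sum_ord2, mxtrace2, det2)/= ?A11; ring.
Qed.

(** The analogue in sl(2) of the formula for the double cross product. *)
Lemma double_bracket A B : \tr A = 0 -> \tr B = 0 ->
  bracket (bracket B A) A = 2 * \tr (A *m A) *: B - 2 * \tr (A *m B) *: A.
Proof.
move=> /traceless2 A11 /traceless2 B11.
apply/matrixP; apply: ord2P; apply: ord2P;
  rewrite /adj2 /gram /bracket !(mxE, sum_ord2, mxtrace2, det2)/= ?(A11, B11); ring.
Qed.

(* Up to normalization, the bracket is the cross product for the trace form, so A, B and
   [B, A] form a basis when the Gram determinant does not vanish. *)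
Lemma sl2_expansion A B P : \tr A = 0 -> \tr B = 0 -> \tr P = 0 ->
  2 * gram A B *: P =
  2 * (\tr (B *m B) * \tr (A *m P) - \tr (A *m B) * \tr (B *m P)) *: A +
  2 * (\tr (A *m A) * \tr (B *m P) - \tr (A *m B) * \tr (A *m P)) *: B -
  \tr (bracket B A *m P) *: bracket B A.
Proof.
move=> /traceless2 A11 /traceless2 B11 /traceless2 P11.
apply/matrixP; apply: ord2P; apply: ord2P;
  rewrite /adj2 /gram /bracket !(mxE, sum_ord2, mxtrace2, det2)/= ?(A11, B11, P11); ring.
Qed.

(** A traceless 2x2 matrix squares to a scalar; for the bracket the value is Lagrange's identity for
    the squared length of a cross product. *)
Lemma bracket_sqr A B : \tr A = 0 -> \tr B = 0 ->
  bracket B A *m bracket B A = (- gram A B)%:M.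
Proof.
move=> /traceless2 A11 /traceless2 B11.
apply/matrixP; apply: ord2P; apply: ord2P;
  rewrite /adj2 /gram /bracket !(mxE, sum_ord2, mxtrace2, det2)/= ?(A11, B11); ring.
Qed.

(** [A *m A] is scalar, hence commutes with [B], so the outer terms of the two products cancel in
    their sum. *)
Lemma bracket_anticomm A B : \tr A = 0 -> \tr B = 0 ->
  bracket B A *m A = - (A *m bracket B A).
Proof.
move=> /traceless2 A11 /traceless2 B11.
apply/matrixP; apply: ord2P; apply: ord2P;
  rewrite /adj2 /gram /bracket !(mxE, sum_ord2, mxtrace2, det2)/= ?(A11, B11); ring.
Qed.

Lemma bracketN A B : bracket A B = - bracket B A.
Proof. by rewrite /bracket opprB. Qed.

End Sl2.

(** * Degenerate pairs have a common left eigenvector *)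

Section CommonEigenvector.
Variable C : numClosedFieldType.

(** A nonzero matrix with two rows has a left kernel of dimension at most one. *)
Lemma row_kernel_proportional n (D : 'M[C]_(2, n)) (l m : 'rV[C]_2) :
  D != 0 -> l != 0 -> l *m D = 0 -> m *m D = 0 -> exists a, m = a *: l.
Proof.
move=> D0 l0 /sub_kermxP lD /sub_kermxP mD.
have rD : (0 < \rank D)%N by rewrite lt0n mxrank_eq0.
have rl : \rank l = 1%N by rewrite rank_rV l0.
have kl : (kermx D <= l)%MS.
  rewrite -(geq_leqif (mxrank_leqif_sup lD)) mxrank_ker rl.
  by rewrite leq_subLR addn1 ltnS.
have /submxP[a ->] := submx_trans mD kl.
by exists (a 0 0); rewrite [a]mx11_scalar mul_scalar_mx mxE eqxx mulr1n.
Qed.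

Lemma stablemx_rV n (v : 'rV[C]_n) (A : 'M[C]_n) : stablemx v A ->
  exists a, v *m A = a *: v.
Proof.
by move=> /submxP[a ->]; exists (a 0 0); rewrite {1}[a]mx11_scalar mul_scalar_mx.
Qed.

(** If [A] and [B] commute, they share an eigenvector over the closed field. Otherwise [D = [B, A]]
    is nonzero of square zero, so any nonzero row of [D] spans its left kernel; [A] and [B]
    anticommute with [D] and therefore preserve this line. *)
Lemma gram0_common_eigenvector (A B : 'M[C]_2) : \tr A = 0 -> \tr B = 0 ->
  gram A B = 0 ->
  exists2 l : 'rV[C]_2, l != 0 &
    (exists a, l *m A = a *: l) /\ (exists b, l *m B = b *: l).
Proof.
move=> trA trB g0; pose D := bracket B A.
have [D0|D0] := eqVneq D 0.
  have [//||l l0 /andP[lA lB]] := @common_eigenvector2 C 2 A B.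
    by apply/esym/eqP; rewrite -subr_eq0; apply/eqP.
  by exists l => //; split; exact: stablemx_rV.
have DD : D *m D = 0 by rewrite bracket_sqr// g0 oppr0; apply/matrixP => i j; rewrite !mxE mul0rn.
have [i l0] : exists i, row i D != 0.
  apply/existsP; apply: contraNT D0 => /existsPn rows0.
  by apply/eqP/row_matrixP => i; rewrite row0; apply/eqP/negPn.
have lD : row i D *m D = 0 by rewrite -row_mul DD row0.
have stab K : D *m K = - (K *m D) -> exists a, row i D *m K = a *: row i D.
  move=> anti; apply: (row_kernel_proportional D0 l0 lD).
  by rewrite -mulmxA -[K *m D]opprK -anti mulmxN mulmxA lD mul0mx oppr0.
exists (row i D) => //; split; apply: stab; first exact: bracket_anticomm.
by rewrite /D bracketN mulmxN mulNmx bracket_anticomm.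
Qed.
End CommonEigenvector.

(** * Controllability forces a nonzero Gram determinant *)

Section Controllability.
Variable R : realType.
Notation mu := (@lebesgue_measure R).
Notation C := R[i].
Notation Re := (@complex.Re R).

Lemma su11_traceless (M : 'M[C]_2) : su11 M -> \tr M = 0.
Proof.
move=> [a [b [c ->]]]; rewrite !mxtraceD !mxtraceZ.
have tr2 (p q r v : C) : \tr (mx2 p q r v) = p + v by rewrite mxtrace2 !mxE.
by rewrite !tr2 addr0 addNr !mulr0 !addr0.
Qed.

Lemma dag_traceless (M : 'M[C]_2) : \tr M = 0 -> \tr (dag M) = 0.
Proof. by rewrite !mxtrace2 !mxE -rmorphD/= => ->; rewrite rmorph0. Qed.

Lemma dagK : involutive (@dag R).
Proof. by move=> M; apply/matrixP => i j; rewrite !mxE conjcK. Qed.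

(** The scalar [y t = l *m X t *m w] solves [y' = (a + u b) y] with [y 0 = 0], hence vanishes by
    uniqueness. *)
Lemma trajectory_eigenrow (A B : 'M[C]_2) (u : R -> R) T X
    (l : 'rV[C]_2) (w : 'cV[C]_2) a b :
  0 <= T -> admissible u T -> trajectory A B u T X ->
  l *m A = a *: l -> l *m B = b *: l -> l *m w = 0 -> l *m X T *m w = 0.
Proof.
move=> T0 ui tr lA lB lw.
have X0 : X 0 = 1%:M by case: tr.
have XF := trajectory_mxprimitive tr.
have := mxprimitiveMr T0 w (mxprimitiveMl T0 l XF) 0 0.
set y := fun t => (l *m X t *m w) 0 0 => yp.
have yk : cprimitive T y (fun t => (a + (u t)%:C * b) * y t).
  apply: eq_cprimitive yp => t _ //.
  rewrite /rhs mulmxA mulmxDr -scalemxAr lA lB scalerA -scalerDl.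
  by rewrite -!scalemxAl mxE.
have ki : mu.-integrable `[0, T] (EFin \o (Re \o (fun t => a + (u t)%:C * b))).
  have := integrable_addr (continuous_compact_integrable (@segment_compact R 0 T)
    (fun x => @cst_continuous _ _ (Re a) x)) (integrable_mulr (Re b) ui).
  apply: eq_integrable => // t _.
  by rewrite /comp; congr (_%:E); rewrite [RHS]raddfD [X in _ = _ + X]ReM /= mul0r subr0 mulrC.
have y0 : y 0 = 0 by rewrite /y X0 mulmx1 lw mxE.
have := linear_cprimitive_eq0 T0 y0 ki yk (t := T).
rewrite T0 lexx => /(_ isT) yT.
by apply/matrixP => i j; rewrite !ord1 [RHS]mxE; exact: yT.
Qed.

(** [rotation] and [boost] preserve no common line of row vectors: the only lines stable under the
    diagonal [rotation] are the coordinate axes, and [boost] moves both. *)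
Definition rotation : 'M[C]_2 := mx2 'i%C 0 0 (- 'i%C).
Definition boost : 'M[C]_2 := mx2 (1 +i* 1) 1 1 (1 -i* 1).

Lemma SU11_rotation : SU11 rotation.
Proof.
split; first by rewrite det2 !mxE/=; apply/eqP; rewrite eq_complex/=; apply/andP; split; apply/eqP; ring.
apply/matrixP; apply: ord2P; apply: ord2P; rewrite !(mxE, sum_ord2)/=;
  apply/eqP; rewrite eq_complex/=; apply/andP; split; apply/eqP; ring.
Qed.

Lemma SU11_boost : SU11 boost.
Proof.
split; first by rewrite det2 !mxE/=; apply/eqP; rewrite eq_complex/=; apply/andP; split; apply/eqP; ring.
apply/matrixP; apply: ord2P; apply: ord2P; rewrite !(mxE, sum_ord2)/=;
  apply/eqP; rewrite eq_complex/=; apply/andP; split; apply/eqP; ring.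
Qed.

Lemma controllable_gram_neq0 (A B : 'M[C]_2) : \tr A = 0 -> \tr B = 0 ->
  controllable A B -> gram A B != 0.
Proof.
move=> trA trB ctrl; apply/eqP => /(gram0_common_eigenvector trA trB).
move=> [l l0 [[a lA] [b lB]]].
(* The row vectors killed by [w] are the multiples of [l], so [l *m Xf *m w = 0] says that [Xf]
   preserves the line of [l]. *)
pose w : 'cV[C]_2 := \col_i (if i == 0 then - l 0 1 else l 0 0).
have lw : l *m w = 0.
  by apply/matrixP => i j; rewrite !ord1 !(mxE, sum_ord2)/=; ring.
have fixed Xf : SU11 Xf -> (l *m Xf *m w) 0 0 = 0.
  move=> /ctrl[u [T [X [T0 [ui [tr <-]]]]]].
  by rewrite (trajectory_eigenrow T0 ui tr lA lB lw) mxE.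
have := fixed _ SU11_rotation; have := fixed _ SU11_boost.
rewrite !(mxE, sum_ord2)/=; set x := l 0 0; set y := l 0 1.
have -> : 1 +i* 1 = 1 + 'i%C :> C by apply/eqP; rewrite eq_complex/= ?addr0 ?add0r !eqxx.
have -> : 1 -i* 1 = 1 - 'i%C :> C by apply/eqP; rewrite eq_complex/= ?oppr0 ?subr0 ?addr0 ?add0r !eqxx.
move=> hb hr.
have i0 : 'i%C != 0 :> C by rewrite eq_complex/= oner_eq0 andbF.
(* For [rotation] the condition reads [- 2 i x y = 0]; for [boost] it reads
   [x^2 - y^2 - 2 i x y = 0]. Together they give [x = y = 0]. *)
have xy0 : x * y = 0.
  have : (2 * 'i%C) * (x * y) = 0 by rewrite -[RHS]oppr0 -hr; ring.
  by move/eqP; rewrite mulf_eq0 (negbTE (mulf_neq0 _ i0)) ?pnatr_eq0// => /eqP.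
have xxyy : x * x = y * y.
  have expand (F : comNzRingType) (p q j : F) :
      (p * (1 + j) + q * 1) * - q + (p * 1 + q * (1 - j)) * p =
      p * p - q * q - 2 * j * (p * q) by ring.
  by move: hb; rewrite expand xy0 mulr0 subr0 => /subr0_eq.
have x0 : x = 0.
  have : x * x * x = 0 by rewrite xxyy -mulrA (mulrC y x) xy0 mulr0.
  by move/eqP; rewrite !mulf_eq0 !orbb => /eqP.
have y0 : y = 0.
  by apply/eqP; rewrite -[_ == 0]orbb -mulf_eq0 -xxyy x0 mul0r.
by move/eqP: l0; apply; apply/matrixP; move=> i; rewrite ord1; apply: ord2P; rewrite mxE.
Qed.
End Controllability.

(** * The adjoint equation and abnormal controls *)

Section Abnormal.
Variable R : realType.
Notation mu := (@lebesgue_measure R).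
Notation C := R[i].
Variables (A B : 'M[C]_2) (u : R -> R) (T : R) (X : R -> 'M[C]_2).
Hypotheses (trA : \tr A = 0) (trB : \tr B = 0).
Let K t : 'M[C]_2 := A + (u t)%:C *: B.

Let trK t : \tr (K t) = 0.
Proof. by rewrite mxtraceD mxtraceZ trA trB mulr0 addr0. Qed.

Lemma mxprimitive_adj2 (Y F : R -> 'M[C]_2) : 0 <= T -> mxprimitive T Y F ->
  mxprimitive T (fun t => adj2 (Y t)) (fun t => adj2 (F t)).
Proof.
move=> T0 YF i j.
have YFt := cprimitiveZ T0 (i == j)%:R (cprimitive_mxtrace YF).
have YFn := cprimitiveZ T0 (-1) (YF i j).
by apply: eq_cprimitive (cprimitiveD YFt YFn) => t _;
  rewrite /adj2 !mxE mulN1r mulr_natl.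
Qed.

(* The adjoint equation: [P = X N X^-1] satisfies [P' = [A + u B, P]]. *)
Lemma cprimitive_conj (M N : 'M[C]_2) : 0 <= T -> trajectory A B u T X ->
  cprimitive T (fun t => \tr (M *m (X t *m N *m adj2 (X t))))
    (fun t => \tr (bracket M (K t) *m (X t *m N *m adj2 (X t)))).
Proof.
move=> T0 trX; have XF := trajectory_mxprimitive trX.
have XNF := mxprimitiveMr T0 N XF.
have PF := mxprimitiveM T0 XNF (mxprimitive_adj2 T0 XF).
apply: eq_cprimitive (cprimitive_mxtrace (mxprimitiveMl T0 M PF)) => t _ //.
rewrite /rhs -/(K t) adj2_mul//; move: (adj2 (X t)) => V.
rewrite mulmxN mulmxDr mulmxN /bracket mulmxBl !mxtraceD !raddfN/=.
by rewrite !mulmxA; congr (_ - _); rewrite mxtrace_mulC !mulmxA.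
Qed.

(** Liouville's formula, obtained from the adjoint equation with [M] and [N] the identity: the
    bracket vanishes, and the trace is [2 \det X] because [X *m adj2 X] is scalar. *)
Lemma trajectory_det t : 0 <= T -> trajectory A B u T X ->
  0 <= t <= T -> \det (X t) = 1.
Proof.
move=> T0 trX t0T; have X0 : X 0 = 1%:M by case: trX.
have det2E s : \tr (1%:M *m (X s *m 1%:M *m adj2 (X s))) = \det (X s) *+ 2.
  by rewrite mul1mx mulmx1 mulmx_adj2 mxtrace_scalar.
have : cprimitive T (fun s => \det (X s) *+ 2) (cst 0).
  apply: eq_cprimitive (cprimitive_conj 1%:M 1%:M T0 trX) => s _; first by rewrite det2E.
  by rewrite /bracket !mul1mx !mulmx1 subrr mul0mx raddf0.
move=> /cprimitive0/(_ t t0T)/eqP; rewrite X0 det1 -subr_eq0 -mulrnBl mulrn_eq0/= subr_eq0.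
by move/eqP.
Qed.

Lemma ip_affine (S Y Z : 'M[C]_2) (v : R) :
  ip S (Y + v%:C *: Z) = ip S Y + v%:C * ip S Z.
Proof.
rewrite /ip !mxtrace2 !(mxE, sum_ord2) !rmorphD !rmorphM/=.
have -> : v -i* 0 = v%:C by rewrite oppr0.
ring.
Qed.

Lemma ip_mxtrace (S Z : 'M[C]_2) : ip S Z = 2 * (\tr (Z *m dag S))^*%C.
Proof.
by rewrite /ip !mxtrace2 !(mxE, sum_ord2) !rmorphD !rmorphM/= !conjcK; ring.
Qed.

(** Comparison of [w] with [w - 1] and [w + 1] gives [q <= 0] and [0 <= q]; in the order on complex
    numbers this forces [q = 0]. *)
Lemma affine_argmin (p q : C) (w : R) :
  (forall v : R, p + w%:C * q <= p + v%:C * q) -> q = 0.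
Proof.
move=> H; apply/le_anti/andP; split.
- by have := H (w - 1); rewrite lerD2l rmorphB/= mulrBl mul1r lerBrDr gerDl.
- by have := H (w + 1); rewrite lerD2l rmorphD/= mulrDl mul1r lerDl.
Qed.

Lemma abnormal_extremal_control : gram A B != 0 -> abnormal_extremal A B T u X ->
  {ae mu, forall t, t \in `[0, T] -> \tr (A *m B) + (u t)%:C * \tr (B *m B) = 0}.
Proof.
move=> g0 [Tp [ui [trX [S [S_su [S0 minS]]]]]]; have T0 := ltW Tp.
pose N := dag S; pose P t := X t *m N *m adj2 (X t).
have trN : \tr N = 0 by apply/dag_traceless/su11_traceless.
have detX t : t \in `[0, T] -> \det (X t) = 1.
  by rewrite inE/= in_itv/=; exact: trajectory_det.
(* Zero slope in [v]: the pairing of [S] with [X^-1 B X] vanishes, and up to a factor 2 and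
   conjugation it is [\tr (B *m P t)] by cyclicity of the trace. *)
have BP0 : {ae mu, forall t, t \in `[0, T] -> \tr (B *m P t) = 0}.
  move: minS; apply: filterS; first exact: (ae_filter_ringOfSetsType mu).
  move=> t /= min_t tT; have dX := detX _ tT.
  have XV : invmx (X t) = adj2 (X t).
    have XU : X t \in unitmx by rewrite unitmxE dX unitr1.
    by rewrite -[LHS]mulmx1 -dX -mulmx_adj2 mulKmx.
  have ipB : ip S (invmx (X t) *m B *m X t) = 0.
    apply: (@affine_argmin (ip S (invmx (X t) *m A *m X t)) _ (u t)) => v.
    have ipK (V Y : 'M[C]_2) r :
        ip S (V *m (A + r%:C *: B) *m Y) = ip S (V *m A *m Y) + r%:C * ip S (V *m B *m Y).
      by rewrite mulmxDr mulmxDl -scalemxAr -scalemxAl ip_affine.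
    by rewrite -(ipK (invmx (X t)) (X t) (u t)) -(ipK (invmx (X t)) (X t) v); exact: min_t.
  move/eqP: ipB; rewrite ip_mxtrace mulf_eq0 pnatr_eq0/= conjc_eq0 => /eqP.
  rewrite XV -!mulmxA mxtrace_mulC => <-.
  by rewrite /P !mulmxA.
have bracketK M t : bracket M (K t) = bracket M A + (u t)%:C *: bracket M B.
  by rewrite /bracket mulmxDr mulmxDl -scalemxAr -scalemxAl scalerBr opprD addrACA.
(* First differentiation. The control drops out since [[B, B] = 0]; the pairing with [B], being
   continuous, vanishes on the whole interval. *)
have [BPz CPz] := cprimitive_ae0 Tp (cprimitive_conj B N T0 trX) BP0.
have CP0 : {ae mu, forall t, t \in `[0, T] -> \tr (bracket B A *m P t) = 0}.
  move: CPz; apply: filterS; first exact: (ae_filter_ringOfSetsType mu).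
  by move=> t /= E tT; rewrite -(E tT) bracketK [bracket B B]subrr scaler0 addr0.
(* Second differentiation, after which [u] appears through [[[B, A], B]]. *)
have [CPz' DPz] := cprimitive_ae0 Tp (cprimitive_conj (bracket B A) N T0 trX) CP0.
move: DPz; apply: filterS; first exact: (ae_filter_ringOfSetsType mu).
move=> t /= E tT; have t0T : 0 <= t <= T by move: tT; rewrite inE/= in_itv.
have {}E := E tT; have BP := BPz _ t0T; have CP := CPz' _ t0T.
rewrite -/(P t) in E BP CP.
have trP : \tr (P t) = 0.
  by rewrite mxtrace_mulC mulmxA mul_adj2mx detX// mul1mx.
(* [P t] is conjugate to [N], the conjugate transpose of the nonzero [S]. *)
have P0 : P t != 0.
  apply/eqP => Pt0; apply: S0; rewrite -(dagK S).
  have : adj2 (X t) *m P t *m X t = N.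
    by rewrite /P !mulmxA mul_adj2mx detX// mul1mx -mulmxA mul_adj2mx detX// mulmx1.
  rewrite Pt0 mulmx0 mul0mx -/N => <-.
  by apply/matrixP => i j; rewrite !mxE rmorph0.
(* [P t] already pairs to zero with [B] and [[B, A]]; if it did with [A] too, its expansion in this
   basis would vanish. *)
have AP : \tr (A *m P t) != 0.
  apply: contra_neq P0 => AP; have := sl2_expansion trA trB trP.
  rewrite AP BP CP !mulr0 subrr mulr0 !scale0r subr0 addr0 => /eqP.
  by rewrite scaler_eq0 mulf_eq0 pnatr_eq0/= (negbTE g0) => /eqP.
(* The double bracket formula with [A] and [B] exchanged, up to sign. *)
have BAB : bracket (bracket B A) B = 2 * \tr (A *m B) *: B - 2 * \tr (B *m B) *: A.
  have bN M Z : bracket (- M) Z = - bracket M Z.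
    by rewrite /bracket mulNmx mulmxN opprB opprK addrC.
  by rewrite (bracketN B A) bN double_bracket// opprB (mxtrace_mulC B A).
move: E; rewrite bracketK double_bracket// BAB !(mulmxDl, mulmxBl, mulNmx) -!scalemxAl.
rewrite !(mxtraceD, raddfN, mxtraceZ)/= mulmxBl -!scalemxAl !(mxtraceD, raddfN, mxtraceZ)/= BP.
rewrite !mulr0 !mxtraceZ => E.
have : 2 * \tr (A *m P t) * (\tr (A *m B) + (u t)%:C * \tr (B *m B)) = 0.
  by rewrite -[RHS]oppr0 -E; ring.
by move/eqP; rewrite !mulf_eq0 pnatr_eq0/= (negbTE AP) => /eqP.
Qed.
End Abnormal.

Theorem theorem3p3 (R : realType) (A B : 'M[R[i]]_2) :
  su11 A -> su11 B -> controllable A B ->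
  (ip B (dag B) <> 0 ->
     forall (T : R) (u : R -> R) (X : R -> 'M[R[i]]_2),
       abnormal_extremal A B T u X ->
       {ae (@lebesgue_measure R), forall t, t \in `[0, T] ->
          (u t)%:C = - (ip A (dag B) / ip B (dag B))}) /\
  (ip B (dag B) = 0 ->
     forall (T : R) (u : R -> R) (X : R -> 'M[R[i]]_2),
       ~ abnormal_extremal A B T u X).
Proof.
move=> /su11_traceless trA /su11_traceless trB /(controllable_gram_neq0 trA trB) g0.
rewrite /ip dagK; split=> [BB T u X abn|BB T u X abn].
  have := abnormal_extremal_control trA trB g0 abn.
  apply: filterS; first exact: (ae_filter_ringOfSetsType (@lebesgue_measure R)).
  move=> t /= E tT; have /eqP := E tT; rewrite addrC addr_eq0 => /eqP E'.
  have BB0 : \tr (B *m B) != 0 by apply/eqP => B0; apply: BB; rewrite B0 mulr0.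
  (* The factors 2 of the inner products cancel, and [- \tr (A *m B)] is [u t] times
     [\tr (B *m B)]. *)
  rewrite -mulf_div divff ?pnatr_eq0// mul1r -mulNr -E' mulfK//.
(* A single time is enough: with [\tr (B *m B) = 0] the equation there gives [\tr (A *m B) = 0], so
   the Gram determinant would vanish. *)
have [t _ E] := ae_itv_exists (proj1 abn) (abnormal_extremal_control trA trB g0 abn).
have BB0 : \tr (B *m B) = 0.
  by move/eqP: BB; rewrite mulf_eq0 pnatr_eq0/= => /eqP.
move: E; rewrite BB0 mulr0 addr0 => AB0.
by move/eqP: g0; apply; rewrite /gram BB0 AB0 expr0n/= mulr0 subrr.
Qed.
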